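(* Assume that $h\ge 1$. Then the group $P$ is an extraspecial group of exponent $p$.
   Context: Let $p$ be an odd prime, $k=\overline{\mathbb{F}}_p$, and $R(X)=\sum_{i=0}^h a_iX^{p^i}\in\mathbb{F}_{p^r}[X]$ with $a_h\neq 0$ (an additive polynomial of degree $p^h$). $C_R$ is the smooth projective absolutely irreducible curve with affine equation $Y^p-Y=XR(X)$; it has a unique point $\infty$ at infinity. Put $E(X)=R(X)^{p^h}+\sum_{i=0}^h (a_iX)^{p^{h-i}}$ and $W=\{c\in k: E(c)=0\}$. For $c\in W$ let $B_c(X)\in Xk[X]$ be the unique polynomial with zero constant term satisfying $B_c(X)^p-B_c(X)=cR(X)+R(c)X$. For $c\in W$ and $b\in k$ with $b^p-b=cR(c)$, let $\sigma_{b,c}$ be the automorphism $(x,y)\mapsto(x+c,\,y+b+B_c(x))$ of $C_R$. $P$ is the group of all such $\sigma_{b,c}$; it is the unique Sylow $p$-subgroup of the group of $k$-automorphisms of $C_R$ fixing $\infty$. A noncommutative $p$-group $G$ is called extraspecial if its center $Z(G)$ has order $p$ and the quotient $G/Z(G)$ is elementary abelian. *)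

(* Defs.v *)
From HB Require Import structures.
From mathcomp Require Import all_boot all_order all_algebra.
From mathcomp Require Import all_fingroup all_solvable all_field.
Set Implicit Arguments.
Unset Strict Implicit.
Unset Printing Implicit Defensive.
Import GRing.Theory.
Local Open Scope ring_scope.

Section Curve.

Variables (k : closedFieldType) (p h : nat) (a : 'I_h.+1 -> k).

Definition R_poly : {poly k} := \sum_(i < h.+1) a i *: 'X^(p ^ i).

Definition E_poly : {poly k} :=
  R_poly ^+ (p ^ h) + \sum_(i < h.+1) (a i *: 'X) ^+ (p ^ (h - i)).

Definition W : {pred k} := [pred c | E_poly.[c] == 0].

Definition is_B (c : k) (B : {poly k}) : Prop :=
  B.[0] = 0 /\ B ^+ p - B = c *: R_poly + R_poly.[c] *: 'X.

Definition on_affine_curve (z : k * k) : bool :=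
  z.2 ^+ p - z.2 == z.1 * R_poly.[z.1].

Definition affine_point : Type := {z : k * k | on_affine_curve z}.

(* The k-points of the smooth projective curve: there is exactly one point at
   infinity, here None. As k is algebraically closed, a k-automorphism is
   determined by the permutation of these points that it induces. *)
Definition curve_point : Type := option affine_point.

(* f is the automorphism sigma_{b,c}. That the displayed pair lies again on
   the curve follows from b^p - b = c R(c) and the equation for B. *)
Definition is_sigma (b c : k) (f : curve_point -> curve_point) : Prop :=
  exists2 B : {poly k}, is_B c B &
    f None = None /\
    forall z : affine_point,
      omap val (f (Some z)) =
        Some ((val z).1 + c, (val z).2 + b + B.[(val z).1]).

Definition in_P (f : curve_point -> curve_point) : Prop :=
  exists b c : k,
    [/\ c \in W, b ^+ p - b = c * R_poly.[c] & is_sigma b c f].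

End Curve.

(* phi identifies the finite group gT with the set P of self-maps of T, the
   product corresponding to composition of maps. *)
Definition group_iso_maps (gT : finGroupType) (T : Type)
    (P : (T -> T) -> Prop) (phi : gT -> T -> T) : Prop :=
  [/\ forall x y : gT, phi (x * y)%g =1 phi x \o phi y,
      forall x y : gT, phi x =1 phi y -> x = y
    & forall f : T -> T, P f <-> exists x : gT, phi x =1 f].

(* The library's [extraspecial] instead asks that the Frattini subgroup and the
   derived subgroup coincide with the center, the latter having prime order. *)
Definition extraspecial_pgroup (p : nat) (gT : finGroupType)
    (G : {group gT}) : Prop :=
  [/\ p.-group G, ~~ abelian G, #|'Z(G)| = p & p.-abelem (G / 'Z(G))]%g.

(* Main.v *)
(* Mapping sigma_{b,c} to (b, c) turns composition into
   (b, c) (b', c') = (b + b' + B_c(c'), c + c'), where B_c(d) is biadditive in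
   (c, d). In such a cocycle group (b, c)^n = (n b + C(n, 2) B_c(c), n c), which is
   trivial for n = p odd, and commutators have c = 0. So everything reduces to
   the nondegeneracy of B_c(d) - B_d(c) on W: for c <> 0 it is a polynomial in d
   of degree p^(2h-1), whereas the separable polynomial E has p^(2h) roots. The
   center is then the set of the (b, 0) with b^p = b, a copy of F_p. *)
Require Import Defs.
From HB Require Import structures.
From mathcomp Require Import all_boot all_order all_algebra.
From mathcomp Require Import all_fingroup all_solvable all_field.
From mathcomp Require Import ring.
Set Implicit Arguments.
Unset Strict Implicit.
Unset Printing Implicit Defensive.
Import GRing.Theory.
Local Open Scope ring_scope.

(** * Products twisted by a biadditive cocycle *)

Definition biadditive (U V : zmodType) (f : V -> V -> U) : Prop :=
  (forall z, {morph f^~ z : x y / x + y}) /\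
  (forall z, {morph f z : x y / x + y}).

(* The proof that f is biadditive is a parameter of this alias of U * V, so that
   the twisted product can be inferred from the type. *)
Definition cocycle_group (U V : zmodType) (f : V -> V -> U) of biadditive f :
  Type := (U * V)%type.

Section CocycleGroup.

Variables (U V : zmodType) (f : V -> V -> U) (f_add : biadditive f).
Local Notation G := (cocycle_group f_add).

Lemma biadditive0l z : f 0 z = 0.
Proof. by apply: (addrI (f 0 z)); rewrite -f_add.1 !addr0. Qed.

Lemma biadditive0r z : f z 0 = 0.
Proof. by apply: (addrI (f z 0)); rewrite -f_add.2 !addr0. Qed.

Lemma biadditiveNl x z : f (- x) z = - f x z.
Proof. by apply/eqP; rewrite -addr_eq0 -f_add.1 addNr biadditive0l. Qed.

Lemma biadditiveNr x z : f x (- z) = - f x z.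
Proof. by apply/eqP; rewrite -addr_eq0 -f_add.2 addNr biadditive0r. Qed.

Lemma biadditiveMnl x z n : f (x *+ n) z = f x z *+ n.
Proof.
by elim: n => [|n IHn]; rewrite ?biadditive0l // !mulrS f_add.1 IHn.
Qed.

Definition cocycle_mul (x y : U * V) : U * V :=
  (x.1 + y.1 + f x.2 y.2, x.2 + y.2).
Definition cocycle_inv (x : U * V) : U * V := (f x.2 x.2 - x.1, - x.2).

Fact cocycle_mulA : associative cocycle_mul.
Proof.
move=> x y z; rewrite /cocycle_mul /= f_add.1 f_add.2 !addrA.
congr (_, _); by rewrite [LHS](ACl (1*2*5*3*6*4)).
Qed.

Fact cocycle_mul0x : left_id (0, 0) cocycle_mul.
Proof. by case=> x y; rewrite /cocycle_mul /= biadditive0l !add0r addr0. Qed.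

Fact cocycle_mulx0 : right_id (0, 0) cocycle_mul.
Proof. by case=> x y; rewrite /cocycle_mul /= biadditive0r !addr0. Qed.

Fact cocycle_mulVx : left_inverse (0, 0) cocycle_inv cocycle_mul.
Proof.
by case=> x y; rewrite /cocycle_mul /= biadditiveNl subrK subrr addNr.
Qed.

Fact cocycle_mulxV : right_inverse (0, 0) cocycle_inv cocycle_mul.
Proof.
by case=> x y; rewrite /cocycle_mul /= biadditiveNr [x + _]addrC subrK !subrr.
Qed.

HB.instance Definition _ := Choice.on G.
HB.instance Definition _ := isGroup.Build G cocycle_mulA cocycle_mul0x
  cocycle_mulx0 cocycle_mulVx cocycle_mulxV.

Lemma cocycle_mulE (x y : G) :
  (x * y)%g = (x.1 + y.1 + f x.2 y.2, x.2 + y.2) :> U * V.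
Proof. by []. Qed.

Lemma cocycle_invE (x : G) : (x^-1)%g = (f x.2 x.2 - x.1, - x.2) :> U * V.
Proof. by []. Qed.

Lemma cocycle_expE (x : G) n :
  (x ^+ n)%g = (x.1 *+ n + f x.2 x.2 *+ 'C(n, 2), x.2 *+ n) :> U * V.
Proof.
elim: n => [|n IHn]; first by rewrite !mulr0n addr0.
rewrite expgSr cocycle_mulE IHn /= biadditiveMnl !mulrSr; congr (_, _).
by rewrite binS bin1 mulrnDr !addrA [LHS](ACl (1*3*2*4)).
Qed.

Lemma cocycle_commute (x y : G) : commute x y <-> f x.2 y.2 = f y.2 x.2.
Proof.
rewrite /commute; split=> [[/eqP]|e].
  by rewrite [y.1 + _]addrC => /eqP/addrI.
by rewrite [LHS]cocycle_mulE e [x.1 + _]addrC [x.2 + _]addrC.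
Qed.

End CocycleGroup.

(** A finite subgroup of a possibly infinite group, given by listing its elements. The closure proof
    is a parameter so that the group structure can be inferred from the type. *)
Definition seq_group (G : groupType) (s : seq G)
  of group_closed (mem s) : Type := seq_sub s.

Section SeqGroup.

Variables (G : groupType) (s : seq G) (s_closed : group_closed (mem s)).

HB.instance Definition _ := SubChoice.on (seq_group s_closed).
HB.instance Definition _ := Finite.on (seq_group s_closed).
HB.instance Definition _ :=
  SubChoice_isSubGroup.Build G (mem s) (seq_group s_closed) s_closed.

End SeqGroup.

(** * A criterion for a finite cocycle group to be extraspecial of exponent p *)

Section SeqCocycleGroup.

Variables (U V : zmodType) (f : V -> V -> U) (f_add : biadditive f).
Variables (s : seq (cocycle_group f_add)) (s_closed : group_closed (mem s)).
Local Notation gT := (seq_group s_closed).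
Variable p : nat.
Hypotheses (p_prime : prime p) (p_odd : odd p).
Hypotheses (Up : forall u : U, u *+ p = 0) (Vp : forall v : V, v *+ p = 0).
Hypothesis f_nondegenerate : forall x, x \in s ->
  (forall y, y \in s -> f x.2 y.2 = f y.2 x.2) -> x.2 = 0.
Hypothesis s_nontrivial : exists2 x, x \in s & x.2 != 0.
Hypothesis card_kernel : #|[set x : gT | (val x).2 == 0]| = p.

Lemma seq_cocycle_exponent_dvd : (exponent [set: gT] %| p)%N.
Proof.
apply/exponentP => x _; apply: val_inj.
rewrite gmulfXn /= cocycle_expE; congr (_, _); last exact: Vp.
(* For odd p the binomial coefficient C(p, 2) = p (p - 1)/2 is a multiple of p. *)
by rewrite Up add0r bin2odd // mulrnA Up mul0rn.
Qed.

Lemma seq_cocycle_center : 'Z([set: gT])%g = [set x : gT | (val x).2 == 0].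
Proof.
apply/setP => x; rewrite inE in_setT inE /=; apply/centP/eqP => [xC|x0 y _].
  apply: f_nondegenerate => [|y sy]; first exact: valP.
  apply/cocycle_commute; have := xC (Sub y sy) (in_setT _).
  move/(congr1 val); rewrite !gmulfM. by [].
apply: val_inj; rewrite !gmulfM; apply/cocycle_commute.
by rewrite x0 biadditive0l // biadditive0r.
Qed.

Lemma seq_cocycle_extraspecial :
  extraspecial_pgroup p [set: gT]%G /\ exponent [set: gT] = p.
Proof.
have [x sx x0] := s_nontrivial.
have expp := seq_cocycle_exponent_dvd.
have nab : ~~ abelian [set: gT].
  apply: contra x0 => /center_idP/setP/(_ (Sub x sx : gT)).
  by rewrite seq_cocycle_center !inE.
split; last first.
  (* The exponent divides p; exponent 1 would make the group trivial, hence abelian. *)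
  apply/eqP; case/primeP: p_prime => _ /(_ _ expp) /orP[e1|//].
  case/negP: nab; have : [set: gT]%G == 1%g :> {set gT}.
    by rewrite trivg_exponent (eqP e1).
  by move/eqP->; apply: abelian1.
split=> //.
- by rewrite -pnat_exponent; apply: pnat_dvd expp _; rewrite pnat_id.
- by rewrite seq_cocycle_center.
(* The exponent bound passes to the quotient, which is abelian because commutators have second
   component 0 and so are central. *)
rewrite abelemE // (dvdn_trans (exponent_quotient _ _) expp) andbT.
apply: sub_der1_abelian; rewrite gen_subG.
apply/subsetP => _ /imset2P[y z _ _ ->].
rewrite /= seq_cocycle_center inE !gmulfM !gmulfV !cocycle_mulE /=.
by rewrite [X in _ + (_ + X)]addrC addKr addNr.
Qed.

End SeqCocycleGroup.

(** * Degree bounds and lists of roots *)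

Lemma size_sum_le (R : nzSemiRingType) (I : finType) (P : pred I)
    (F : I -> {poly R}) n :
  (forall i, P i -> (size (F i) <= n)%N) ->
  (size (\sum_(i | P i) F i)%R <= n)%N.
Proof.
by move=> Fn; apply: leq_trans (size_sum _ _ _) _; apply/bigmax_leqP.
Qed.

(** Roots are repeated according to multiplicity, so the length is the degree when [q] is
    nonzero. *)
Definition root_seq (k : closedFieldType) (q : {poly k}) : seq k :=
  sval (closed_field_poly_normal q).

Lemma root_seqE (k : closedFieldType) (q : {poly k}) :
  q = lead_coef q *: \prod_(z <- root_seq q) ('X - z%:P).
Proof. exact: svalP (closed_field_poly_normal q). Qed.

Lemma mem_root_seq (k : closedFieldType) (q : {poly k}) x :
  q != 0 -> (x \in root_seq q) = (q.[x] == 0).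
Proof.
move=> q0; rewrite -rootE [in RHS](root_seqE q) rootZ ?lead_coef_eq0 //.
by rewrite root_prod_XsubC.
Qed.

Lemma size_root_seq (k : closedFieldType) (q : {poly k}) :
  q != 0 -> size q = (size (root_seq q)).+1.
Proof.
move=> q0; rewrite [in LHS](root_seqE q) size_scale ?lead_coef_eq0 //.
by rewrite size_prod_XsubC.
Qed.

Lemma uniq_root_seq (k : closedFieldType) (q : {poly k}) :
  q != 0 -> separable_poly q -> uniq (root_seq q).
Proof.
move=> q0 sq; rewrite -separable_prod_XsubC; move: sq.
rewrite {1}[q]root_seqE.
by rewrite (eqp_separable (eqp_scale _ _)) // lead_coef_eq0.
Qed.

(** * Polynomials that define additive functions *)

Definition additive_poly (R : comNzRingType) (q : {poly R}) : Prop :=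
  {morph (fun x => q.[x]) : x y / x + y}.

Section AdditivePolynomials.

Variables (R : comNzRingType) (p : nat) (pcharR : p \in [pchar R]).
Implicit Types q : {poly R}.

Lemma additive_poly_hornerB q x y :
  additive_poly q -> q.[x - y] = q.[x] - q.[y].
Proof. by move=> qD; apply/eqP; rewrite eq_sym subr_eq -qD subrK. Qed.

Lemma additive_poly_horner0 q : additive_poly q -> q.[0] = 0.
Proof.
by move=> qD; rewrite -[X in q.[X]](subrr 0) additive_poly_hornerB ?subrr.
Qed.

Lemma additive_polyXn i : additive_poly ('X^(p ^ i) : {poly R}).
Proof.
move=> x y; rewrite !hornerXn exprDn_pchar // pnatX.
by rewrite (eq_pnat _ (pcharf_eq pcharR)) pnat_id ?(pcharf_prime pcharR).
Qed.

Lemma additive_polyX : additive_poly ('X : {poly R}).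
Proof. exact: (additive_polyXn 0). Qed.

Lemma additive_polyZ c q : additive_poly q -> additive_poly (c *: q).
Proof. by move=> qD x y; rewrite !hornerZ qD mulrDr. Qed.

Lemma additive_polyN q : additive_poly q -> additive_poly (- q).
Proof. by move=> qD x y; rewrite !hornerN qD opprD. Qed.

Lemma additive_polyD q1 q2 :
  additive_poly q1 -> additive_poly q2 -> additive_poly (q1 + q2).
Proof. by move=> q1D q2D x y; rewrite !hornerD q1D q2D addrACA. Qed.

Lemma additive_poly_sum (I : finType) (P : pred I) (F : I -> {poly R}) :
  (forall i, P i -> additive_poly (F i)) -> additive_poly (\sum_(i | P i) F i).
Proof.
move=> FD x y; rewrite !horner_sum -big_split; apply: eq_bigr => i /FD.
exact.
Qed.

Lemma additive_polyX_pchar q i :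
  additive_poly q -> additive_poly (q ^+ (p ^ i)).
Proof.
move=> qD x y; have := additive_polyXn i q.[x] q.[y].
by rewrite !hornerXn !horner_exp qD.
Qed.

End AdditivePolynomials.

(** * The polynomials E and B_c, and the pairing B_c(d) *)

Section CurvePolynomials.

Variables (k : closedFieldType) (p h : nat) (a : 'I_h.+1 -> k).
Hypothesis (pchark : p \in [pchar k]).
Hypotheses (h_gt0 : (0 < h)%N) (a_h : a ord_max != 0).

Local Notation R := (R_poly p a).
Local Notation E := (E_poly p a).

Let p_gt1 : (1 < p)%N. Proof. exact/prime_gt1/(pcharf_prime pchark). Qed.
Let p_gt0 : (0 < p)%N. Proof. exact: ltnW. Qed.

(* For c in W, comparing coefficients in B^p - B = c R(X) + R(c) X forces the
   coefficient of X^(p^i) in B_c to be - (trunc_poly i)(c); the last relation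
   is trunc_poly h = E vanishing at c. *)
Definition trunc_poly i : {poly k} :=
  R ^+ (p ^ i) + \sum_(j < h.+1 | (j <= i)%N) (a j *: 'X) ^+ (p ^ (i - j)).

Definition B_poly c : {poly k} :=
  - \sum_(i < h) (trunc_poly i).[c] *: 'X^(p ^ i).

Lemma trunc_poly0 : trunc_poly 0 = R + a ord0 *: 'X.
Proof.
rewrite /trunc_poly expr1 big_mkcond big_ord_recl /= big1 ?addr0 //=.
Qed.

(** Frobenius raises every exponent [p ^ (i - j)] to [p ^ (i.+1 - j)]; the only new summand is the
    linear one, [j = i.+1]. *)
Lemma trunc_polyS (i : 'I_h) :
  trunc_poly i.+1 = trunc_poly i ^+ p + a (lift ord0 i) *: 'X.
Proof.
have pcharP : p \in [pchar {poly k}] by rewrite pchar_poly.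
rewrite /trunc_poly (bigD1 (lift ord0 i)) //= subnn expr1.
rewrite -!(pFrobenius_autE pcharP) rmorphD rmorph_sum /= !pFrobenius_autE.
rewrite -exprM -expnSr -addrA [X in _ + X]addrC; congr (_ + (_ + _)).
rewrite [LHS](eq_bigl (fun j : 'I_h.+1 => (j <= i)%N)); last first.
  by move=> j; rewrite -val_eqE /= /bump /= add1n andbC -ltn_neqAle.
apply: eq_bigr => j ji; rewrite pFrobenius_autE -exprM -expnSr subSn //.
Qed.

Lemma horner_trunc_polyS c (i : 'I_h) :
  (trunc_poly i.+1).[c] = (trunc_poly i).[c] ^+ p + a (lift ord0 i) * c.
Proof. by rewrite trunc_polyS hornerD horner_exp hornerZ hornerX. Qed.

Lemma trunc_poly_last : trunc_poly h = E.
Proof.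
by congr (_ + _); apply: eq_bigl => j; rewrite -ltnS ltn_ord.
Qed.

(** By the recurrence for [trunc_poly], the p-th power of [g i] is [g i.+1] minus a term of
    [c *: R], so the sum telescopes to [g 0 - g h]. Here [g 0] supplies the linear terms and [g h]
    the error term with E(c). *)
Lemma B_polyP c : B_poly c ^+ p - B_poly c =
  c *: R + R.[c] *: 'X - E.[c] *: 'X^(p ^ h).
Proof.
have pcharP : p \in [pchar {poly k}] by rewrite pchar_poly.
pose g i := (trunc_poly i).[c] *: 'X^(p ^ i) : {poly k}.
rewrite /B_poly -(pFrobenius_autE pcharP) rmorphN rmorph_sum opprK /=.
rewrite (eq_bigr (fun i : 'I_h =>
  g i.+1 - (c * a (lift ord0 i)) *: 'X^(p ^ i.+1))); last first.
  move=> i _; rewrite pFrobenius_autE exprZn -exprM -expnSr /g.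
  by rewrite horner_trunc_polyS scalerDl [c * _]mulrC addrK.
rewrite sumrB opprB addrAC -addrA -sumrB.
rewrite -(big_mkord xpredT (fun i => g i - g i.+1)).
under eq_bigr do rewrite -opprB.
rewrite sumrN telescope_sumr // opprB {1}/R_poly big_ord_recl scalerDr.
rewrite /g trunc_poly0 trunc_poly_last expr1 (hornerD R) hornerZ hornerX /=.
rewrite addrA; congr (_ - _).
rewrite [LHS]addrC scalerDl [RHS]addrC addrA scaler_sumr scalerA.
rewrite [c * a ord0]mulrC; congr (_ + _).
by apply: eq_bigr => i _; rewrite scalerA.
Qed.

Lemma horner_B_poly0 c : (B_poly c).[0] = 0.
Proof.
rewrite /B_poly hornerN horner_sum big1 ?oppr0 // => i _.
by rewrite hornerZ hornerXn expr0n expn_eq0 -leqn0 leqNgt p_gt0 mulr0.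
Qed.

Lemma additive_R_poly : additive_poly R.
Proof.
apply: additive_poly_sum => i _; apply: additive_polyZ.
exact: additive_polyXn.
Qed.

Lemma additive_trunc_poly i : additive_poly (trunc_poly i).
Proof.
apply: additive_polyD; first exact/additive_polyX_pchar/additive_R_poly.
apply: additive_poly_sum => j _; apply: additive_polyX_pchar => //.
exact/additive_polyZ/(additive_polyX pchark).
Qed.

Lemma additive_E_poly : additive_poly E.
Proof. by rewrite -trunc_poly_last; apply: additive_trunc_poly. Qed.

Lemma additive_B_poly c : additive_poly (B_poly c).
Proof.
apply/additive_polyN/additive_poly_sum => i _; apply: additive_polyZ.
exact: additive_polyXn.
Qed.

Lemma B_polyD c d : B_poly (c + d) = B_poly c + B_poly d.
Proof.
rewrite /B_poly -opprD -big_split; congr (- _); apply: eq_bigr => i _ /=.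
by rewrite additive_trunc_poly scalerDl.
Qed.

(** This holds on all of k, not only on W, so the ambient cocycle group can be taken on k x k. *)
Lemma biadditive_B_poly : biadditive (fun c d => (B_poly c).[d]).
Proof.
by split=> z x y; rewrite ?B_polyD ?hornerD // additive_B_poly.
Qed.

Lemma is_B_B_poly c : c \in W p a -> is_B p a c (B_poly c).
Proof.
rewrite inE => /eqP Ec; split; first exact: horner_B_poly0.
by rewrite B_polyP Ec scale0r subr0.
Qed.

(* The difference D of two solutions satisfies D^p = D, so it is constant, and
   it vanishes at 0. *)
Lemma is_B_unique c B1 B2 : is_B p a c B1 -> is_B p a c B2 -> B1 = B2.
Proof.
move=> [B10 B1P] [B20 B2P]; apply/eqP; rewrite -subr_eq0; set D := B1 - B2.
have pcharP : p \in [pchar {poly k}] by rewrite pchar_poly.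
have DP : D ^+ p = D.
  rewrite -(pFrobenius_autE pcharP) rmorphB /= !pFrobenius_autE.
  rewrite -[B1 ^+ p](subrK B1) B1P -B2P.
  by rewrite addrAC [B2 ^+ p - B2]addrC addrK addrC.
(* A positive degree n + 1 would satisfy n + 1 = (n + 1) p. *)
have : (size D <= 1)%N.
  have := size_exp D p; rewrite DP; case: (size D) => [|[|n]] //= /eqP.
  rewrite -{1}[n.+1]muln1 eqn_pmul2l // => /eqP p1.
  by move: p_gt1; rewrite -p1.
move/size1_polyC=> DC.
by rewrite DC -(hornerC D`_0 0) -DC !hornerE B10 B20 subrr.
Qed.

Lemma size_R_poly : size R = (p ^ h).+1.
Proof.
rewrite /R_poly big_ord_recr /= addrC size_polyDl ?size_scale ?size_polyXn //.
rewrite ltnS; apply: size_sum_le => i _.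
apply: leq_trans (size_scale_leq _ _) _.
by rewrite size_polyXn ltn_exp2l.
Qed.

(** The power of R dominates: the other summands have degree at most [p ^ i], which is below
    [p ^ (h + i)] since h > 0. *)
Lemma size_trunc_poly i : size (trunc_poly i) = (p ^ (h + i)).+1.
Proof.
have sz : size (R ^+ (p ^ i)) = (p ^ (h + i)).+1.
  have := size_exp R (p ^ i); rewrite size_R_poly -expnD /= => <-.
  rewrite prednK // lt0n size_poly_eq0 expf_neq0 //.
  by rewrite -size_poly_eq0 size_R_poly.
rewrite /trunc_poly size_polyDl // sz ltnS; apply: size_sum_le => j _.
rewrite exprZn; apply: leq_trans (size_scale_leq _ _) _.
rewrite size_polyXn ltn_exp2l //; apply: leq_ltn_trans (leq_subr _ _) _.
by rewrite -[X in (X < _)%N]add0n ltn_add2r.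
Qed.

Lemma size_E_poly : size E = (p ^ h.*2).+1.
Proof. by rewrite -trunc_poly_last size_trunc_poly addnn. Qed.

Lemma E_poly_neq0 : E != 0.
Proof. by rewrite -size_poly_eq0 size_E_poly. Qed.

(** Proper p-th powers have zero derivative; only the summand [i = h], with exponent [p ^ 0],
    survives. *)
Lemma deriv_E_poly : E^`() = (a ord_max)%:P.
Proof.
have dX (q : {poly k}) i : (0 < i)%N -> (q ^+ (p ^ i))^`() = 0.
  have pcharP : p \in [pchar {poly k}] by rewrite pchar_poly.
  case: i => // i _; rewrite deriv_exp expnS mulrnA -[_ *+ p]mulr_natr.
  by rewrite (pcharf0 pcharP) mulr0 mul0rn.
rewrite /E_poly derivD dX // add0r raddf_sum big_ord_recr /= big1 => [|i _].
  by rewrite add0r subnn expr1 derivZ derivX alg_polyC.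
by rewrite dX // subn_gt0.
Qed.

Lemma separable_E_poly : separable_poly E.
Proof.
rewrite unlock deriv_E_poly -alg_polyC coprimepZr //.
exact: coprimep1.
Qed.

Lemma W_root_seq c : (c \in root_seq E) = (c \in W p a).
Proof. by rewrite mem_root_seq ?E_poly_neq0 // inE. Qed.

Lemma B_poly_nondegenerate c :
  (forall d, d \in W p a -> (B_poly c).[d] = (B_poly d).[c]) -> c = 0.
Proof.
move=> cW; apply/eqP; apply/negPn/negP => c0.
have h1h : (h.-1 < h)%N by rewrite prednK.
pose N := (p ^ (h + h.-1))%N.
(* Q(d) = B_c(d) - B_d(c) has degree p^(2h-1), too small to vanish on W. *)
pose Q := B_poly c + \sum_(i < h) c ^+ (p ^ i) *: trunc_poly i.
(* The coefficients of B_d are themselves polynomials in d, so - B_d(c) is the value at d of the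
   second summand of [Q]. *)
have QW d : d \in W p a -> root Q d.
  move=> dW; rewrite rootE hornerD cW // /B_poly hornerN !horner_sum.
  rewrite addrC subr_eq0; apply/eqP/eq_bigr => i _.
  by rewrite !hornerZ hornerXn mulrC.
have szB : (size (B_poly c) <= N)%N.
  rewrite size_polyN; apply: size_sum_le => i _.
  apply: leq_trans (size_scale_leq _ _) _; rewrite size_polyXn ltn_exp2l //.
  by apply: leq_trans (ltn_ord i) _; apply: leq_addr.
have szQ : (size Q <= N.+1)%N.
  rewrite (leq_trans (size_polyD _ _)) // geq_max leqW // size_sum_le // => i _.
  rewrite (leq_trans (size_scale_leq _ _)) // size_trunc_poly ltnS.
  by rewrite leq_exp2l // leq_add2l -ltnS prednK.
(* In degree [N] only [i = h.-1] contributes: [c ^+ (p ^ h.-1)] times the leading coefficient of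
   [trunc_poly h.-1]. *)
have Qneq0 : Q != 0.
  apply/negP => /eqP/(congr1 (fun q : {poly k} => q`_N)).
  rewrite coefD nth_default // add0r coef0 coef_sum.
  rewrite (bigD1 (Ordinal h1h)) //= big1 ?addr0 => [/eqP|i ih].
    rewrite coefZ mulf_eq0 expf_eq0 (negPf c0) andbF.
    rewrite -[N]/N.+1.-1 -size_trunc_poly.
    by rewrite [_ == 0]lead_coef_eq0 -size_poly_eq0 size_trunc_poly.
  rewrite coefZ nth_default ?mulr0 // size_trunc_poly ltn_exp2l // ltn_add2l.
  by rewrite ltn_neqAle -ltnS prednK // ltn_ord andbT.
have QE : all (root Q) (root_seq E).
  by apply/allP => d; rewrite W_root_seq; apply: QW.
have := max_poly_roots Qneq0 QE (uniq_root_seq E_poly_neq0 separable_E_poly).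
rewrite -ltnS -size_root_seq ?E_poly_neq0 // size_E_poly ltnS => ltWQ.
have := leq_trans ltWQ szQ; rewrite ltnS leqNgt => /negP; apply.
by rewrite ltn_exp2l // -addnn ltn_add2l.
Qed.

Lemma W_nontrivial : exists2 c, c \in W p a & c != 0.
Proof.
have sE : (1 < size (root_seq E))%N.
  rewrite -ltnS -size_root_seq ?E_poly_neq0 // size_E_poly ltnS.
  by rewrite -{1}(expn0 p) ltn_exp2l // double_gt0.
have uE := uniq_root_seq E_poly_neq0 separable_E_poly.
have WE c : c \in root_seq E -> c \in W p a by rewrite W_root_seq.
case: (root_seq E) sE uE WE => [|c [|d r]] //= _ /andP[cd _] WE.
have [c0|c0] := eqVneq c 0; last by exists c => //; rewrite WE ?mem_head.
exists d; first by rewrite WE // in_cons mem_head orbT.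
by apply: contraNneq cd => d0; rewrite c0 d0 mem_head.
Qed.

Lemma W_closed : zmod_closed (W p a).
Proof.
split=> [|c d]; rewrite !inE.
  by rewrite (additive_poly_horner0 additive_E_poly).
move=> /eqP Ec /eqP Ed.
by rewrite (additive_poly_hornerB _ _ additive_E_poly) Ec Ed subrr.
Qed.

End CurvePolynomials.

(** * Realizing P as a finite cocycle group acting on the curve *)

Section CurveAutomorphisms.

Variables (k : closedFieldType) (p h : nat) (a : 'I_h.+1 -> k).
Hypothesis (pchark : p \in [pchar k]).
Hypotheses (h_gt0 : (0 < h)%N) (a_h : a ord_max != 0).

Local Notation R := (R_poly p a).
Local Notation B := (B_poly p a).
Local Notation cpoint := (curve_point p a).
Local Notation pairs := (cocycle_group (biadditive_B_poly a pchark)).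

(* The pair (b, c) stands for sigma_{b,c}; the cocycle B_c(d) reflects the
   composition law of these maps. *)
Definition P_seq : seq pairs :=
  [seq (b, c) | c <- root_seq (E_poly p a),
                b <- root_seq ('X^p - 'X - (c * R.[c])%:P)].

Let p_gt1 : (1 < p)%N. Proof. exact/prime_gt1/(pcharf_prime pchark). Qed.

Let size_AS_poly (e : k) : size ('X^p - 'X - e%:P : {poly k}) = p.+1.
Proof.
rewrite -addrA size_polyDl size_polyXn // ltnS -opprD size_polyN.
rewrite (leq_trans (size_polyD _ _)) // geq_max size_polyX p_gt1.
by rewrite (leq_trans (size_polyC_leq1 _)) // ltnW.
Qed.

Lemma P_seqP (x : pairs) : reflect
  (x.2 \in W p a /\ x.1 ^+ p - x.1 = x.2 * R.[x.2]) (x \in P_seq).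
Proof.
have memAS (e b : k) : (b \in root_seq ('X^p - 'X - e%:P)) = (b ^+ p - b == e).
  by rewrite mem_root_seq -?size_poly_eq0 ?size_AS_poly // !hornerE subr_eq0.
case: x => b c; apply: (iffP allpairsPdep).
  move=> [c' [b' [Ec ASb [-> ->]]]]; rewrite /= -(W_root_seq pchark h_gt0 a_h).
  by split=> //; apply/eqP; rewrite -memAS.
move=> /= [Wc ASb].
by exists c, b; rewrite (W_root_seq pchark h_gt0 a_h) memAS ASb.
Qed.

Lemma B_poly_AS c x : c \in W p a ->
  (B c).[x] ^+ p - (B c).[x] = c * R.[x] + R.[c] * x.
Proof.
move=> Wc; have [_ BP] := is_B_B_poly pchark Wc.
by rewrite -horner_exp -hornerN -hornerD BP !hornerE.
Qed.

(** The projection from P to W is onto, since k is algebraically closed; this carries statements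
    about W over to P. *)
Lemma P_seq_lift c : c \in W p a -> exists b, ((b, c) : pairs) \in P_seq.
Proof.
move=> Wc; have : size ('X^p - 'X - (c * R.[c])%:P) != 1%N.
  by rewrite size_AS_poly eqSS -lt0n ltnW.
case/closed_rootP=> b; rewrite rootE !hornerE subr_eq0 => /eqP bP.
by exists b; apply/P_seqP.
Qed.

Let ASD (x y : k) : (x + y) ^+ p - (x + y) = (x ^+ p - x) + (y ^+ p - y).
Proof.
by rewrite -!(pFrobenius_autE pchark) rmorphD opprD addrACA.
Qed.

Let ASB (x y : k) : (x - y) ^+ p - (x - y) = (x ^+ p - x) - (y ^+ p - y).
Proof. by apply/eqP; rewrite eq_sym subr_eq -ASD subrK. Qed.

(** The Artin-Schreier map z -> z^p - z is additive and sends B_c(d) to c R(d) + R(c) d, the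
    polarization of c R(c). Hence the condition on b is compatible with the twisted product. *)
Lemma P_seq_closed : group_closed (mem P_seq).
Proof.
have [W0 WB] := W_closed a pchark.
have RD := additive_R_poly a pchark.
split=> [|x y /P_seqP[Wx ASx] /P_seqP[Wy ASy]]; apply/P_seqP.
  by rewrite /= W0 mul0r expr0n gtn_eqF ?subrr // ltnW.
rewrite cocycle_mulE cocycle_invE /=; split; first exact: WB.
rewrite ASD ASD ASB !B_poly_AS // ASx ASy.
rewrite (additive_poly_hornerB _ _ RD).
have -> : R.[- y.2] = - R.[y.2].
  by rewrite -sub0r (additive_poly_hornerB _ _ RD) additive_poly_horner0 ?sub0r.
ring.
Qed.

(* insub gives the junk value None when x is outside P_seq and the displayed
   pair misses the curve. *)
Definition sigma (x : pairs) (q : cpoint) : cpoint :=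
  if q is Some z then
    insub ((val z).1 + x.2, (val z).2 + x.1 + (B x.2).[(val z).1])
  else None.

(** Expand (x + c) R(x + c): the term x R(x) comes from y, the mixed terms from B_c(x), and c R(c)
    from b. *)
Lemma val_sigma (x : pairs) (z : affine_point p a) : x \in P_seq ->
  omap val (sigma x (Some z)) =
  Some ((val z).1 + x.2, (val z).2 + x.1 + (B x.2).[(val z).1]).
Proof.
case/P_seqP=> Wx ASx; rewrite /= insubT //=.
rewrite /on_affine_curve /= !ASD B_poly_AS // ASx (eqP (valP z)).
by rewrite (additive_R_poly a pchark); apply/eqP; ring.
Qed.

Lemma curve_pointP (q1 q2 : cpoint) : omap val q1 = omap val q2 -> q1 = q2.
Proof. by case: q1 q2 => [z1|] [z2|] //= [/val_inj ->]. Qed.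

(** The outer map evaluates its B at a translated abscissa; additivity splits off exactly the
    cocycle term. *)
Lemma sigma_mul (x y : pairs) : x \in P_seq -> y \in P_seq ->
  sigma (x * y)%g =1 sigma x \o sigma y.
Proof.
move=> Px Py [z|] //; apply: curve_pointP.
have Pxy : (x * y)%g \in P_seq.
  by apply: group_closedM => //; apply: P_seq_closed.
have := val_sigma z Py; case yz: (sigma y (Some z)) => [z'|] // [z'E].
rewrite val_sigma // /comp yz val_sigma //= z'E /=.
rewrite B_polyD // (additive_B_poly a pchark) hornerD.
congr (Some (_, _)); ring.
Qed.

Fact origin_on_curve : on_affine_curve p a (0, 0).
Proof. by rewrite /on_affine_curve /= mul0r expr0n gtn_eqF ?subrr // ltnW. Qed.

(** As B_c(0) = 0, the origin is sent to (c, b), which determines the pair. *)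
Lemma sigma_inj : {in P_seq &, forall x y, sigma x =1 sigma y -> x = y}.
Proof.
move=> [b c] [b' c'] Px Py /(_ (Some (Sub (0, 0) origin_on_curve))).
move/(congr1 (omap val)); rewrite !val_sigma //= !horner_B_poly0 //.
by rewrite !add0r !addr0 => -[-> ->].
Qed.

Lemma in_P_sigma (f : cpoint -> cpoint) :
  in_P f <-> exists2 x : pairs, x \in P_seq & sigma x =1 f.
Proof.
split=> [[b [c [Wc ASb [B' B'P [f0 fE]]]]]|[x Px fE]].
  have Px : ((b, c) : pairs) \in P_seq by apply/P_seqP.
  exists (b, c) => // -[z|] //; apply: curve_pointP; rewrite val_sigma // fE.
  (* [is_sigma] provides only some solution [B']; uniqueness identifies it with [B_poly]. *)
  by rewrite (is_B_unique pchark B'P (is_B_B_poly pchark Wc)).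
have [Wx ASx] := P_seqP _ Px.
exists x.1, x.2; split=> //; exists (B x.2); first exact: is_B_B_poly.
by split=> [|z]; rewrite -fE // val_sigma.
Qed.

(** For c = 0 the condition is b^p = b. Since X^p - X is the product of the X - z for z in F_p, the
    solutions are exactly the images of F_p. *)
Lemma card_P_seq_kernel (iota : {rmorphism 'F_p -> k})
    (sP : group_closed (mem P_seq)) :
  #|[set x : seq_group sP | (val x).2 == 0]| = p.
Proof.
have p_prime := pcharf_prime pchark.
(* The default value 1 is never reached, by [Pz]. *)
pose g (z : 'F_p) : seq_group sP :=
  insubd (1%g : seq_group sP) ((iota z, 0) : pairs).
have cardF z : z ^+ p = z :> 'F_p by rewrite -{2}(expf_card z) card_Fp.
have Pz z : ((iota z, 0) : pairs) \in P_seq.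
  apply/P_seqP; have [W0 _] := W_closed a pchark.
  by rewrite /= W0 mul0r -rmorphXn /= cardF subrr.
have gE z : val (g z) = (iota z, 0) by rewrite val_insubd Pz.
have g_inj : injective g.
  by move=> z1 z2 /(congr1 val); rewrite !gE => -[/fmorph_inj].
rewrite -[RHS](card_Fp p_prime) -cardsT -(card_imset _ g_inj).
congr #|pred_of_set _|; apply/setP=> x; rewrite inE.
apply/eqP/imsetP => [x0|[z _ ->]].
  have [_ ASx] := P_seqP _ (valP x).
  have : root (map_poly iota ('X^#|'F_p| - 'X)) (val x).1.
    rewrite card_Fp // rmorphB /= map_polyXn map_polyX rootE !hornerE ASx x0.
    by rewrite mul0r.
  rewrite finField_genPoly rmorph_prod rootE horner_prod => /prodf_eq0[z _].
  rewrite rmorphB /= map_polyX map_polyC -rootE root_XsubC => /eqP xz.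
  exists z => //; apply: val_inj; rewrite gE -xz -x0; exact: surjective_pairing.
by rewrite gE.
Qed.

End CurveAutomorphisms.

Theorem theorem5p3 (p : nat) (p_prime : prime p) (p_odd : odd p)
    (* k is an algebraic closure of F_p *)
    (k : closedFieldType) (iota : {rmorphism 'F_p -> k})
    (k_alg : integralRange iota)
    (* F is the subfield of k with p^r elements, embedded by j *)
    (r : nat) (F : finFieldType) (F_card : #|F| = (p ^ r)%N)
    (j : {rmorphism F -> k})
    (h : nat) (a : 'I_h.+1 -> F) (a_h : a ord_max != 0) (h_ge1 : (1 <= h)%N) :
  exists (gT : finGroupType)
         (phi : gT -> curve_point p (j \o a) -> curve_point p (j \o a)),
    [/\ group_iso_maps (in_P (a := j \o a)) phi,
        extraspecial_pgroup p [set: gT]%G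
      & exponent [set: gT] = p].
Proof.
have pchark : p \in [pchar k] by rewrite (fmorph_pchar iota) pchar_Fp.
have ja : (j \o a) ord_max != 0 by rewrite /= fmorph_eq0.
set s := P_seq (j \o a) pchark.
have sP : group_closed (mem s) := P_seq_closed pchark h_ge1 ja.
pose gT : finGroupType := seq_group sP.
have torsion (x : k) : x *+ p = 0 by rewrite -mulr_natr (pcharf0 pchark) mulr0.
have nondeg x : x \in s ->
    (forall y, y \in s ->
      (B_poly p (j \o a) x.2).[y.2] = (B_poly p (j \o a) y.2).[x.2]) ->
    x.2 = 0.
  (* Every d in W lifts to an element of [s], so commuting with all of [s] tests the pairing against
     all of W. *)
  move=> sx xC; apply: (B_poly_nondegenerate pchark h_ge1 ja) => d Wd.
  have [b sbd] := P_seq_lift pchark h_ge1 ja Wd.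
  exact: xC _ sbd.
have nontriv : exists2 x, x \in s & x.2 != 0.
  have [c Wc c0] := W_nontrivial pchark h_ge1 ja.
  have [b sbc] := P_seq_lift pchark h_ge1 ja Wc.
  by exists (b, c).
have kernel := card_P_seq_kernel h_ge1 ja iota sP.
have [Pext Pexp] :=
  seq_cocycle_extraspecial p_prime p_odd torsion torsion nondeg nontriv kernel.
exists gT, (fun x => sigma (val x)); split=> //; split=> [x y|x y|f].
- by rewrite gmulfM; apply: sigma_mul => //; apply: valP.
- by move/(sigma_inj h_ge1 ja) => xy; apply: val_inj; apply: xy; apply: valP.
rewrite (in_P_sigma pchark h_ge1 ja); split=> [[x sx xf]|[x xf]].
  by exists (Sub x sx : gT).
by exists (val x) => //; apply: valP.
Qed.
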